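(* Let $X,Y$ be bounded degree graphs. If $f$ is a coarse embedding of $X$ into $Y$ and $X$ has exponentially many fat bigons at a vertex $x_0$, then $Y$ has exponentially many fat bigons at $y_0=f(x_0)$. In particular, having exponentially many fat bigons does not depend on the choice of basepoint: for any vertices $x_0,x_0'$ of a bounded degree graph $X$, $X$ has exponentially many fat bigons at $x_0$ if and only if it has exponentially many fat bigons at $x_0'$.
   Context: All graphs are connected, have uniformly bounded degree, and are metric spaces with the shortest path metric (edges of length 1). For $r\ge 0$, $B_r(x)$ is the closed ball of radius $r$ about $x$, and $N_r(Y)=\{x : d(x,Y)\le r\}$. Let $X$ be a graph with base vertex $x_0$, and let $x$ be a vertex. Given $L\ge 1$ and $s,C\ge 0$, an $(L,s,C)$-bigon at $x$ (with respect to $x_0$) is a pair of paths $\alpha_1,\alpha_2$ in $X$ from $x_0$ to $x$ such that (1) the length satisfies $l(\alpha_i)\le L\,d(x_0,x)$ for $i=1,2$; (2) with $B=N_C(\{x_0,x\})$, we have $d(\alpha_1\setminus B,\alpha_2\setminus B)>s$ (this holds by convention if one of the two sets is empty). Let $\mathcal B^X(L,s,C)$ be the set of vertices $x$ such that there exists an $(L,s,C)$-bigon at $x$. $X$ has exponentially many fat bigons at $x_0$ if there exist constants $s_0,c,L>1$ such that for every $s\ge s_0$ there exists $C$ such that $|\mathcal B^X(L,s,C)\cap B_n(x_0)|\ge c^n$ for infinitely many $n\in\mathbb N$. A coarse embedding of a graph $X$ into a graph $Y$, with vertex sets $VX$, $VY$, is a map $f:VX\to VY$ for which there are a constant $K\ge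 1$ and a function $\rho:\mathbb N\to\mathbb N$ with $\rho(n)\to\infty$ as $n\to\infty$ such that $\rho(d_X(x,y))\le d_Y(f(x),f(y))\le K d_X(x,y)$ for all $x,y\in VX$. *)

(* Defs.v *)
From mathcomp Require Import all_boot all_order all_algebra finmap.
From mathcomp Require Import boolp classical_sets functions cardinality.
From mathcomp Require Import reals ereal topology.

Set Implicit Arguments.
Unset Strict Implicit.
Unset Printing Implicit Defensive.

Import Order.TTheory GRing.Theory Num.Theory.

Local Open Scope classical_set_scope.
Local Open Scope ring_scope.

Section EdgePaths.
Context {V : eqType} (e : rel V).

(* The path with vertices x :: p goes from x to y; its length is size p. *)
Definition path_from_to (x : V) (p : seq V) (y : V) : Prop :=
  path e x p /\ last x p = y.

Definition joined_in (x y : V) (n : nat) : Prop :=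
  exists2 p : seq V, path_from_to x p y & size p = n.

End EdgePaths.

(* Connected simple graphs, of arbitrary cardinality. *)
Record graph := Graph {
  vertex :> choiceType;
  adj : rel vertex;
  adj_sym : symmetric adj;
  adj_irr : irreflexive adj;
  adj_connected : forall x y : vertex, exists n, `[< joined_in adj x y n >]
}.

Definition bounded_degree (X : graph) : Prop :=
  exists D : nat, forall x : X, ([set y | adj x y] #<= `I_D)%card.

Definition gdist (X : graph) (x y : X) : nat := ex_minn (adj_connected x y).

Definition vball (X : graph) (n : nat) (x : X) : set X :=
  [set y | (gdist x y <= n)%N].

Section MetricGraph.
Context {R : realType} {X : graph}.

(* Points of the geometric realization: EdgePoint u v t is the interior point
   of the edge {u, v} at distance t from u and 1 - t from v.  Thus
   EdgePoint u v t and EdgePoint v u (1 - t) represent the same point. *)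
Inductive point : Type :=
| Vertex of X
| EdgePoint (u v : X) (t : R) of adj u v & 0 < t < 1.

Definition vpdist (w : X) (a : point) : R :=
  match a with
  | Vertex v => (gdist w v)%:R
  | EdgePoint u v t _ _ =>
      Num.min ((gdist w u)%:R + t) ((gdist w v)%:R + (1 - t))
  end.

(* The shortest path metric with edges of length 1.  Between interior points
   of distinct edges a shortest path leaves the first edge through one of its
   endpoints. *)
Definition pdist (a b : point) : R :=
  match a, b with
  | Vertex w, _ => vpdist w b
  | _, Vertex w => vpdist w a
  | EdgePoint u v t _ _, EdgePoint u' v' t' _ _ =>
      if (u == u') && (v == v') then `|t - t'|
      else if (u == v') && (v == u') then `|t - (1 - t')|
      else Num.min (t + vpdist u b) ((1 - t) + vpdist v b)
  end.

(* As ereal_inf set0 = +oo, the distance to an empty set is infinite. *)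
Definition set_dist (A B : set point) : \bar R :=
  ereal_inf [set (pdist ab.1 ab.2)%:E | ab in A `*` B].

Definition nbhd (r : R) (A : set point) : set point :=
  [set a | (set_dist [set a] A <= r%:E)%E].

(* The subset of the realization covered by the edge path x :: p. *)
Definition trace (x : X) (p : seq X) : set point :=
  [set a | match a with
           | Vertex w => w \in x :: p
           | EdgePoint u v _ _ _ =>
               ((u, v) \in zip (x :: p) p) || ((v, u) \in zip (x :: p) p)
           end].

Definition bigon (L s C : R) (x0 x : X) (p1 p2 : seq X) : Prop :=
  let B := nbhd C [set Vertex x0; Vertex x] in
  [/\ path_from_to (@adj X) x0 p1 x,
      path_from_to (@adj X) x0 p2 x,
      (size p1)%:R <= L * (gdist x0 x)%:R,
      (size p2)%:R <= L * (gdist x0 x)%:R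
    & (s%:E < set_dist (trace x0 p1 `\` B) (trace x0 p2 `\` B))%E].

Definition bigon_vertices (x0 : X) (L s C : R) : set X :=
  [set x | exists p1 p2 : seq X, bigon L s C x0 x p1 p2].

End MetricGraph.

(* The set counted here is finite when X has bounded degree; fset_set would
   send an infinite set to the empty one. *)
Definition exponentially_many_fat_bigons
    (R : realType) (X : graph) (x0 : X) : Prop :=
  exists s0 c L : R, [/\ 1 < s0, 1 < c, 1 < L &
    forall s : R, s0 <= s -> exists2 C : R, 0 <= C &
      infinite_set [set n : nat |
        c ^+ n <= #|` fset_set (bigon_vertices x0 L s C `&` vball n x0)|%:R]].

Definition coarse_embedding (R : realType) (X Y : graph) (f : X -> Y) : Prop :=
  exists (K : R) (rho : nat -> nat), [/\ 1 <= K, rho @ \oo --> \oo &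
    forall x y : X, (rho (gdist x y) <= gdist (f x) (f y))%N /\
      (gdist (f x) (f y))%:R <= K * (gdist x y)%:R].

(* Main.v *)
Require Import Defs.
From mathcomp Require Import all_boot all_order all_algebra finmap.
From mathcomp Require Import boolp classical_sets functions cardinality.
From mathcomp Require Import reals ereal topology.
From mathcomp Require Import zify ring lra.

(** Push a bigon of [X] forward by joining the images of consecutive vertices by
    geodesics of [Y].  The new paths stay within a constant [k] of the images of
    the old ones and are at most [k] times as long; a point of a new path far
    from both endpoints is therefore close to the image of a vertex far from
    both endpoints of the old one, and properness of the coarse embedding turns
    a large enough separation of the old paths into the wanted separation of the
    new ones ([bigon_push]).  Each point of a realization is replaced by an
    endpoint of its edge, so that all of this takes place between vertices.

    The length condition is the delicate point: a coarse embedding may shrink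
    distances arbitrarily, so [gdist (f x0) (f x)] need not be comparable with
    [gdist x0 x] and the pushed paths may be too long.  Counting repairs this.
    The vertices [x] of the [n]-ball with [gdist (f x0) (f x) <= n %/ q] are
    mapped into a ball of [Y] of size at most [E ^ (n %/ q)] ([ball_cover]) by a
    map whose fibers have at most [M] elements ([fiber_cover]).  Taking [q]
    with [E <= b ^+ q], where [b] is the square root of the growth constant [c],
    leaves at most [M * b ^+ n] such vertices, negligible against [c ^+ n].  For
    all the others [gdist x0 x <= q * gdist (f x0) (f x)], and the pushed bigons
    have length constant [k * L * q].  Their endpoints are at most [M]-to-1
    images lying in the ball of radius [k * n], which costs only a [k]-th root
    in the growth constant.

    Independence of the basepoint is the case of the self-map that sends [x0] to
    [x0'] and fixes every other vertex: it moves vertices by a bounded amount,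
    hence is a coarse embedding. *)

Set Implicit Arguments.
Unset Strict Implicit.
Unset Printing Implicit Defensive.

Import Order.TTheory GRing.Theory Num.Theory.

Local Open Scope classical_set_scope.
Local Open Scope ring_scope.

(** * The shortest path metric and ball growth *)

Section GraphDistance.
Context {X : graph}.
Implicit Types (x y z u v w : X) (p : seq X).

Lemma gdist_path x y :
  exists2 p, path_from_to (@adj X) x p y & size p = gdist x y.
Proof. by rewrite /gdist; case: ex_minnP => n /asboolP[p]; exists p. Qed.

Lemma gdist_le_size x y p :
  path_from_to (@adj X) x p y -> (gdist x y <= size p)%N.
Proof.
move=> xpy; rewrite /gdist; case: ex_minnP => n _; apply.
by apply/asboolP; exists p.
Qed.

Lemma gdistxx x : gdist x x = 0%N.
Proof. by apply/eqP; rewrite -leqn0; apply: (@gdist_le_size x x [::]). Qed.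

Lemma gdist_adj x y : adj x y -> (gdist x y <= 1)%N.
Proof. by move=> xy; apply: (@gdist_le_size x y [:: y]); split; rewrite /= ?xy. Qed.

Lemma gdist_triangle x y z : (gdist x z <= gdist x y + gdist y z)%N.
Proof.
have [p [xp py] <-] := gdist_path x y; have [q [yq qz] <-] := gdist_path y z.
rewrite -size_cat; apply: gdist_le_size.
by split; rewrite ?cat_path ?last_cat ?xp py.
Qed.

Lemma gdist_mem_path x p w : path (@adj X) x p -> w \in x :: p ->
  (gdist x w <= size p)%N.
Proof.
elim: p x => [|z p IHp] x /=; first by rewrite inE => _ /eqP ->; rewrite gdistxx.
move=> /andP[xz zp]; rewrite inE => /orP[/eqP ->|wp]; first by rewrite gdistxx.
apply: leq_trans (gdist_triangle x z w) _.
by rewrite -add1n leq_add ?gdist_adj ?IHp.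
Qed.

Lemma gdist_sym_le x y : (gdist y x <= gdist x y)%N.
Proof.
have [p [xp <-] <-] := gdist_path x y.
rewrite -(size_belast x) -size_rev; apply: gdist_le_size; split.
  by rewrite rev_path (eq_path (e' := @adj X)) // => u v; rewrite adj_sym.
by case: p {xp} => //= z p; rewrite rev_cons last_rcons.
Qed.

Lemma gdist_sym x y : gdist x y = gdist y x.
Proof. by apply/eqP; rewrite eqn_leq !gdist_sym_le. Qed.

Lemma gdist_gt0 x y : x != y -> (0 < gdist x y)%N.
Proof.
have [p [_ py] <-] := gdist_path x y.
by case: p py => //= <-; rewrite eqxx.
Qed.

(** The growth bound: a ball of radius [n.+1] is covered by the balls of radius
    [n] about the at most [D.+1] points of the closed neighbourhood of its
    centre, where [D] bounds the degrees. *)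
Lemma ball_cover : bounded_degree X ->
  exists2 E, (0 < E)%N & forall n x,
    exists2 s : seq X, (size s <= E ^ n)%N &
      forall y, (gdist x y <= n)%N -> y \in s.
Proof.
move=> [D degD]; exists D.+1 => //; elim=> [|n IHn] x.
  exists [:: x] => // y; rewrite leqn0 => /eqP xy.
  by rewrite inE eq_sym; case: eqVneq => // /gdist_gt0; rewrite xy.
have [s sP] := choice (fun z => let: ex_intro2 s a b := IHn z in
  ex_intro (fun s : seq X => (size s <= D.+1 ^ n)%N /\
    forall y, (gdist z y <= n)%N -> y \in s) s (conj a b)).
have nbfin : finite_set [set y | adj x y].
  by apply: card_le_finite (degD x) _; apply: finite_II.
pose nb := enum_fset (fset_set [set y | adj x y]).
have nbD : (size nb <= D)%N by apply/geq_card_fset_set.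
exists (flatten [seq s z | z <- x :: nb]).
  have H (t : seq X) : (size (flatten [seq s z | z <- t]) <= size t * D.+1 ^ n)%N.
    elim: t => //= z t IHt; rewrite size_cat mulSn leq_add //.
    by case: (sP z).
  by rewrite (leq_trans (H _)) // expnS leq_mul2r /= ltnS nbD orbT.
move=> y xyn; apply/flatten_mapP.
have [p [xp py] sp] := gdist_path x y.
case: p xp py sp => [|z p] /= xp py sp.
  by exists x; rewrite ?inE ?eqxx //; apply: (sP x).2; rewrite -py gdistxx.
move/andP: xp => [xz zp]; exists z.
  by rewrite inE; apply/orP; right; rewrite in_fset_set // inE.
apply: (sP z).2; rewrite -ltnS; apply: leq_trans xyn; rewrite -sp ltnS.
exact: gdist_le_size.
Qed.

Lemma finite_vball n x : bounded_degree X -> finite_set (vball n x).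
Proof.
move=> /ball_cover[E _ /(_ n x)[s _ sP]].
by apply: sub_finite_set (finite_seq s) => y; apply: sP.
Qed.

End GraphDistance.

(** * From points of the realization to vertices *)

Section Anchors.
Context {R : realType} {X : graph}.
Implicit Types (a b : @Defs.point R X) (w x u v : X) (p : seq X).

Definition anchor a : X :=
  match a with Vertex v => v | EdgePoint u _ _ _ _ => u end.

Lemma mem_zip_cons x p u v : (u, v) \in zip (x :: p) p ->
  (u \in x :: p) && (v \in x :: p).
Proof.
elim: p x => //= z p IHp x; rewrite inE => /orP[/eqP[-> ->]|/IHp/andP[]].
  by rewrite !inE !eqxx orbT.
by rewrite ![_ \in x :: _]inE => -> ->; rewrite !orbT.
Qed.

Lemma anchor_trace x p a : trace x p a -> anchor a \in x :: p.
Proof. by case: a => [//|u v t ? ?] /= /orP[] /mem_zip_cons/andP[]. Qed.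

Let ler_natD (m n k : nat) : (m <= n + k)%N -> m%:R <= n%:R + k%:R :> R.
Proof. by rewrite -natrD ler_nat. Qed.

Lemma vpdist_le_anchor w a : vpdist w a <= (gdist (anchor a) w)%:R + 1.
Proof.
rewrite gdist_sym; case: a => [v|u v t uv /andP[t0 t1]] /=; first lra.
by rewrite ge_min; apply/orP; left; lra.
Qed.

Lemma gdist_anchor_le_vpdist w a : (gdist w (anchor a))%:R <= vpdist w a + 1.
Proof.
case: a => [v|u v t uv /andP[t0 t1]] /=; first lra.
have := ler_natD (leq_trans (gdist_triangle w v u)
  (leq_add (leqnn _) (gdist_adj (etrans (adj_sym v u) uv)))).
by rewrite minEle; case: ifP => _; lra.
Qed.

(** Replacing a point by an endpoint of its edge costs at most 1 on each side,
    so separation in the realization can be read off from vertices. *)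
Lemma gdist_anchor_le_pdist a b :
  (gdist (anchor a) (anchor b))%:R <= pdist a b + 2.
Proof.
case: a => [w|u v t uv tI] /=; first by have := gdist_anchor_le_vpdist w b; lra.
case: b => [w|u' v' t' uv' tI'].
  have := @gdist_anchor_le_vpdist w (EdgePoint uv tI).
  by rewrite /= (gdist_sym u w); lra.
have Hu := @gdist_anchor_le_vpdist u (EdgePoint uv' tI').
have Hv := @gdist_anchor_le_vpdist v (EdgePoint uv' tI').
have Huv := ler_natD (leq_trans (gdist_triangle u v u')
  (leq_add (gdist_adj uv) (leqnn _))).
have [t0 t1] := andP tI.
move: Hu Hv; set b := EdgePoint uv' tI' => Hu Hv.
have -> : anchor b = u' by [].
case: ifP => [/andP[/eqP <- _]|_].
  by rewrite gdistxx; have := normr_ge0 (t - t'); lra.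
case: ifP => [/andP[_ /eqP <-]|_].
  have : (gdist u v)%:R <= 1%:R :> R by rewrite ler_nat gdist_adj.
  by have := normr_ge0 (t - (1 - t')); lra.
(* Starting from [v] costs one more step, since [gdist u u' <= 1 + gdist v u']. *)
change (anchor b) with u' in Hu, Hv.
by rewrite minEle; case: ifP => _; lra.
Qed.

Lemma anchor_far_of_notin_nbhd C x y a : ~ nbhd C [set Vertex x; Vertex y] a ->
  C < (gdist (anchor a) x)%:R + 1 /\ C < (gdist (anchor a) y)%:R + 1.
Proof.
move=> naC.
suff H w : (w = x \/ w = y) -> C < (gdist (anchor a) w)%:R + 1.
  by split; apply: H; [left|right].
move=> wxy; rewrite ltNge; apply/negP => dC; apply: naC; rewrite /nbhd /=.
apply: ge_ereal_inf; exists (pdist a (Vertex w))%:E.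
  by exists (a, Vertex w) => //; split => //=; case: wxy => ->; [left|right].
rewrite lee_fin; apply: le_trans dC.
apply: le_trans (vpdist_le_anchor w a).
by case: (a) => [v|*] /=; rewrite 1?gdist_sym.
Qed.

Lemma vertex_notin_nbhd C x y v :
  C < (gdist v x)%:R -> C < (gdist v y)%:R ->
  ~ nbhd C [set Vertex x; Vertex y] (@Vertex R X v).
Proof.
move=> Cx Cy; rewrite /nbhd /=; apply/negP; rewrite -ltNge.
apply: (@lt_le_trans _ _ (Num.min (gdist v x)%:R (gdist v y)%:R)%:E).
  by rewrite lte_fin lt_min Cx Cy.
apply: le_ereal_inf_tmp => _ [[a b] /= [-> ab] <-]; case: ab => ->.
  by rewrite lee_fin ge_min lexx.
by rewrite lee_fin ge_min lexx orbT.
Qed.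

End Anchors.

(** * Pushing bigons forward *)

Section CoarseMap.
Context {X Y : graph} (f : X -> Y) (k : nat)
  (f_lip : forall x y, (gdist (f x) (f y) <= k * gdist x y)%N).

(** The image path concatenates geodesics of length at most [k] between the
    images of consecutive vertices, so each of its vertices is within [k] of the
    image of the start of its geodesic. *)
Lemma push_path x p y : path_from_to (@adj X) x p y ->
  exists q, [/\ path_from_to (@adj Y) (f x) q (f y),
    (size q <= k * size p)%N &
    forall w, w \in f x :: q -> exists2 v, v \in x :: p & (gdist w (f v) <= k)%N].
Proof.
elim: p x => [|z p IHp] x [/= xp py].
  exists [::]; split=> //; first by rewrite py.
  by move=> w; rewrite inE => /eqP ->; exists x; rewrite ?mem_head ?gdistxx.
move/andP: xp => [xz zp]; have [q [[fzq qfy] sq qP]] := IHp z (conj zp py).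
have [g [fxg gfz] sg] := gdist_path (f x) (f z).
have gk : (size g <= k)%N.
  rewrite sg; apply: leq_trans (f_lip x z) _.
  by rewrite -[leqRHS]muln1 leq_mul2l gdist_adj ?orbT.
exists (g ++ q); split.
- by split; rewrite ?cat_path ?last_cat ?fxg gfz.
- by rewrite size_cat /= mulnS leq_add.
move=> w; rewrite -cat_cons mem_cat => /orP[wg|wq]; last first.
  have [|v vp wv] := qP w; first by rewrite inE wq orbT.
  by exists v; rewrite // inE vp orbT.
exists x; rewrite ?mem_head // gdist_sym.
exact: leq_trans (gdist_mem_path fxg wg) gk.
Qed.

Section Bigons.
(* In the margin [2 * k + 3], [2 * k] is for the two vertices near the pushed
   paths, 2 for replacing two points by anchors, and 1 makes the separation of
   the pushed paths strict after taking the infimum. *)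
Context {R : realType} (L s s' C : R) (q : nat) (L_ge0 : 0 <= L)
  (f_sep : forall x y, s < (gdist x y)%:R ->
     s' + (2 * k + 3)%:R <= (gdist (f x) (f y))%:R).

Let C' := k%:R * C + k%:R + 1.

(** If [anchor a] lies within [k] of [f v] and [v] were within [C] of an endpoint
    [z], then [anchor a] would be within [k + k * C] of [f z]; the remaining 1 in
    [C'] pays for replacing [a] by its anchor. *)
Lemma far_preimage x0 x p p' a :
  (forall w, w \in f x0 :: p' -> exists2 v, v \in x0 :: p & (gdist w (f v) <= k)%N) ->
  (trace (f x0) p' `\` nbhd C' [set Vertex (f x0); Vertex (f x)]) a ->
  exists2 v, (trace x0 p `\` nbhd C [set Vertex x0; Vertex x]) (@Vertex R X v) &
    (gdist (anchor a) (f v) <= k)%N.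
Proof.
move=> near [/anchor_trace/near[v vp av] /anchor_far_of_notin_nbhd[a0 ax]].
exists v => //; split=> //.
have H z : C' < (gdist (anchor a) (f z))%:R + 1 -> C < (gdist v z)%:R.
  rewrite /C' => az; rewrite ltNge; apply/negP => vz.
  have := ler_wpM2l (ler0n R k) vz.
  have : (gdist (anchor a) (f z) <= k + k * gdist v z)%N.
    by apply: leq_trans (gdist_triangle _ (f v) _) _; apply: leq_add.
  by rewrite -(ler_nat R) natrD natrM; lra.
exact: vertex_notin_nbhd (H _ a0) (H _ ax).
Qed.

(** The hypothesis that [f x] is not too close to [f x0] is what keeps the
    lengths of the pushed paths linear in the distance of their endpoints. *)
Lemma bigon_push x0 x : (gdist x0 x <= q * gdist (f x0) (f x))%N ->
  bigon_vertices x0 L s C x ->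
  bigon_vertices (f x0) (k%:R * L * q%:R) s' C' (f x).
Proof.
move=> dq [p1 [p2 [xp1 xp2 sp1 sp2 sep]]].
have [p1' [yp1 sp1' near1]] := push_path xp1.
have [p2' [yp2 sp2' near2]] := push_path xp2.
have len p p' : (size p' <= k * size p)%N -> (size p)%:R <= L * (gdist x0 x)%:R ->
    (size p')%:R <= k%:R * L * q%:R * (gdist (f x0) (f x))%:R.
  rewrite -(ler_nat R) natrM => pp' pL; apply: le_trans pp' _.
  rewrite -!mulrA ler_wpM2l // (le_trans pL) // ler_wpM2l //.
  by rewrite -natrM ler_nat.
exists p1', p2'; split=> //; [exact: len sp1' sp1|exact: len sp2' sp2|].
apply: (@lt_le_trans _ _ (s' + 1)%:E); first by rewrite lte_fin; lra.
apply: le_ereal_inf_tmp => _ [[a b] [/= aT bT] <-].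
have [v vT av] := far_preimage near1 aT; have [w wT bw] := far_preimage near2 bT.
have vw : s < (gdist v w)%:R.
  rewrite -lte_fin; apply: lt_le_trans sep _; apply: ereal_inf_lbound.
  by exists (Vertex v, Vertex w).
have := f_sep vw; have := gdist_anchor_le_pdist a b.
have : (gdist (f v) (f w) <= 2 * k + gdist (anchor a) (anchor b))%N.
  have := gdist_triangle (f v) (anchor a) (f w).
  have := gdist_triangle (anchor a) (anchor b) (f w).
  by rewrite (gdist_sym (f v) (anchor a)); lia.
by rewrite -(ler_nat R) !natrD lee_fin; lra.
Qed.

End Bigons.
End CoarseMap.

(** * Counting tools *)

Section Counting.
Context {R : realType}.

Lemma card_le_fiber (A B : choiceType) (f : A -> B) M (F : {fset A}) (t : seq B) :
  (forall y, exists2 s : seq A, (size s <= M)%N & forall x, f x = y -> x \in s) ->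
  (forall x, x \in F -> f x \in t) -> (#|` F| <= size t * M)%N.
Proof.
move=> fib Ft.
have [s sP] := choice (fun y => let: ex_intro2 s a b := fib y in
  ex_intro (fun s : seq A => (size s <= M)%N /\
    forall x, f x = y -> x \in s) s (conj a b)).
apply: (@leq_trans (size (flatten [seq s y | y <- t]))).
  apply: uniq_leq_size (fset_uniq F) _ => x /Ft xt; apply/flatten_mapP.
  by exists (f x) => //; apply: (sP (f x)).2.
elim: t {Ft} => //= y t IHt; rewrite size_cat mulSn leq_add //.
by case: (sP y).
Qed.

(** Bernoulli's inequality and the Archimedean property. *)
Lemma exp_unbounded (c A : R) : 1 < c ->
  exists N : nat, forall n, (N <= n)%N -> A <= c ^+ n.
Proof.
move=> c1; pose t := c - 1; have t0 : 0 < t by rewrite subr_gt0.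
have B n : n%:R * t <= c ^+ n.
  elim: n => [|n IHn]; first by rewrite mul0r ler01.
  have : 1 <= c ^+ n by apply: exprn_ege1; apply: ltW.
  move=> cn1.
  have tc : t <= t * c ^+ n by rewrite ler_peMr // ltW.
  rewrite exprS -natr1 (_ : c * c ^+ n = c ^+ n + t * c ^+ n); last by rewrite /t; ring.
  lra.
exists (Num.bound `|A / t|) => n Nn; apply: le_trans (B n).
rewrite -ler_pdivrMr //; apply: le_trans (ler_norm _) _.
apply: le_trans (ltW (archi_boundP (normr_ge0 _))) _.
by rewrite ler_nat.
Qed.

(** Taking the minimum with [Num.sqrt c] lets the induction split [c] as a
    product: one factor [Num.sqrt c] for the new power, one for the others. *)
Lemma exists_root_gt1 (c : R) (k : nat) : 1 < c ->
  exists2 d : R, 1 < d & d ^+ k <= c.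
Proof.
elim: k c => [|k IHk] c c1; first by exists 2; rewrite ?ltr1n // expr0 ltW.
have r1 : 1 < Num.sqrt c by rewrite -sqrtr1 ltr_sqrt ?(lt_trans ltr01).
have [d d1 dk] := IHk _ r1.
have m1 : 1 < Num.min d (Num.sqrt c) by rewrite lt_min d1.
exists (Num.min d (Num.sqrt c)) => //; rewrite exprS.
have c0 : 0 <= c by apply/ltW/(lt_trans ltr01).
rewrite -[leRHS]sqr_sqrtr // expr2 ler_pM ?exprn_ge0 ?(ltW (lt_trans ltr01 m1)) //.
  by rewrite ge_min lexx orbT.
apply: le_trans dk; apply: lerXn2r; rewrite ?nnegrE ?(ltW (lt_trans ltr01 _)) //.
by rewrite ge_min lexx.
Qed.

End Counting.

(** * Coarse embeddings preserve exponentially many fat bigons *)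

(** The two uses of a coarse embedding, over [nat]: a Lipschitz bound, which
    controls how paths are pushed, and properness, which controls fibers and the
    separation of pushed paths. *)
Lemma coarse_embedding_nat (R : realType) (X Y : graph) (f : X -> Y) :
  coarse_embedding R f ->
  (exists2 k, (0 < k)%N & forall x y, (gdist (f x) (f y) <= k * gdist x y)%N) /\
  forall m, exists r, forall x y, (r <= gdist x y)%N -> (m <= gdist (f x) (f y))%N.
Proof.
move=> [K [rho [K1 rhoy fP]]]; split.
  have K0 := ltW (lt_le_trans ltr01 K1).
  exists (Num.bound K).
    by have := lt_le_trans ltr01 (le_trans K1 (ltW (archi_boundP K0))); rewrite ltr0n.
  move=> x y; rewrite -(ler_nat R) natrM; apply: le_trans (fP x y).2 _.
  by rewrite ler_wpM2r // ltW // archi_boundP.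
move=> m; have /cvgnyPge/(_ m)[r _ rm] := rhoy.
by exists r => x y /rm mr; apply: leq_trans mr (fP x y).1.
Qed.

Section PushAll.
Context {R : realType} (X Y : graph) (f : X -> Y) (x0 : X)
  (degX : bounded_degree X) (degY : bounded_degree Y)
  (coarse_f : coarse_embedding R f).

(** By properness two points of the same fiber are at bounded distance, so a
    fiber lies in a ball of fixed radius about any of its points. *)
Lemma fiber_cover : exists2 M, (0 < M)%N &
  forall y, exists2 s : seq X, (size s <= M)%N & forall x, f x = y -> x \in s.
Proof.
have [_ /(_ 1%N)[r fr]] := coarse_embedding_nat coarse_f.
have [E E0 EP] := ball_cover degX.
exists (E ^ r)%N; first by rewrite expn_gt0 E0.
move=> y; have [[x' fx']|noy] := pselect (exists x, f x = y); last first.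
  by exists [::] => // x fx; case: noy; exists x.
have [s sE sP] := EP r x'; exists s => // x fx; apply: sP.
rewrite leqNgt; apply/negP => /ltnW/fr.
by rewrite fx fx' gdistxx.
Qed.

Lemma exponentially_many_fat_bigons_push : exponentially_many_fat_bigons R x0 ->
  exponentially_many_fat_bigons R (f x0).
Proof.
move=> [s0 [c [L [s01 c1 L1 many]]]].
have [[k k0 lip] proper] := coarse_embedding_nat coarse_f.
have [M M0 fib] := fiber_cover.
have [E E0 EP] := ball_cover degY.
pose b := Num.sqrt c.
have c0 : 0 < c := lt_trans ltr01 c1.
have b1 : 1 < b by rewrite -sqrtr1 ltr_sqrt.
have bb : b * b = c by rewrite -expr2 sqr_sqrtr // ltW.
have [d d1 dk] := exists_root_gt1 k b1.
have [q0 q0P] := exp_unbounded E%:R b1.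
(* The successor makes [q] positive, so that [n %/ q] is a genuine quotient. *)
pose q := q0.+1; have qE : E%:R <= b ^+ q by apply: q0P; rewrite leqnSn.
have [N NP] := exp_unbounded (2 * M)%:R b1.
exists 2, d, (k%:R * L * q%:R); split=> //; first by rewrite ltr1n.
  have : 1 <= k%:R :> R by rewrite ler1n.
  have : 1 <= q%:R :> R by rewrite ler1n.
  move=> q1 k1; apply: lt_le_trans (L1) _; rewrite mulrAC ler_peMl ?mulr_ege1 //.
  exact: ltW (lt_trans ltr01 L1).
move=> s s2.
pose m := Num.bound (s + (2 * k + 3)%:R).
have sm : s + (2 * k + 3)%:R <= m%:R.
  by apply/ltW/archi_boundP; rewrite addr_ge0 // (le_trans _ s2).
have [r rP] := proper m.
pose sX := Num.max s0 r%:R.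
have sep x y : sX < (gdist x y)%:R -> s + (2 * k + 3)%:R <= (gdist (f x) (f y))%:R.
  rewrite gt_max => /andP[_]; rewrite ltr_nat => /ltnW/rP.
  by rewrite -(ler_nat R); apply: le_trans.
have [|C C0 inf] := many sX; first by rewrite le_max lexx.
pose C' := k%:R * C + k%:R + 1.
exists C'; first by rewrite !addr_ge0 // mulr_ge0.
have finY j := finite_setIr (bigon_vertices (f x0) (k%:R * L * q%:R) s C')
  (finite_vball j (f x0) degY).
(* The endpoints split into those with image in the ball of radius [n %/ q],
   whose images are listed by [t], and those where [bigon_push] applies. *)
have count n : (N <= n)%N ->
    c ^+ n <= #|` fset_set (bigon_vertices x0 L sX C `&` vball n x0)|%:R ->
    d ^+ (k * n) <= #|` fset_set (bigon_vertices (f x0) (k%:R * L * q%:R) s C'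
                              `&` vball (k * n) (f x0))|%:R.
  move=> Nn; set S := fset_set _; set T := fset_set _ => cS.
  have [t tE tP] := EP (n %/ q)%N (f x0).
  have : (#|` S| <= size (t ++ enum_fset T) * M)%N.
    apply: card_le_fiber fib _ => x.
    rewrite in_fset_set; last exact: finite_setIr (finite_vball n x0 degX).
    rewrite inE => -[bx xn]; rewrite mem_cat.
    have [fx_near|] := leqP (gdist (f x0) (f x)) (n %/ q); first by rewrite tP.
    rewrite ltn_divLR // => /ltnW fx_far; apply/orP; right.
    rewrite in_fset_set // inE; split.
      apply: (bigon_push lip _ sep _ bx); first exact: ltW (lt_trans ltr01 L1).
      by rewrite (leq_trans xn) // mulnC.
    by apply: leq_trans (lip _ _) _; rewrite leq_mul2l xn orbT.
  rewrite size_cat -(ler_nat R) natrM natrD => ST.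
  have tb : (size t)%:R <= b ^+ n.
    apply: (@le_trans _ _ ((E ^ (n %/ q))%:R)); first by rewrite ler_nat.
    rewrite natrX; apply: (@le_trans _ _ (b ^+ (q * (n %/ q)))).
      by rewrite exprM lerXn2r ?nnegrE // exprn_ge0 // ltW // (lt_trans ltr01).
    by apply: ler_weXn2l; rewrite ?ltW // mulnC leq_divM.
  have bn := NP n Nn; rewrite natrM in bn.
  rewrite exprM; apply: (@le_trans _ _ (b ^+ n)).
    by rewrite lerXn2r ?nnegrE ?exprn_ge0 // ltW // (lt_trans ltr01).
  have M1 : 1 <= M%:R :> R by rewrite ler1n.
  rewrite -bb exprMn in cS.
  have bn0 : 0 <= b ^+ n by rewrite exprn_ge0 // ltW // (lt_trans ltr01).
  (* [2 * M * b ^+ n <= b ^+ n * b ^+ n = c ^+ n <= (b ^+ n + #|` T|) * M] *)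
  rewrite -(ler_pM2r (lt_le_trans ltr01 M1)).
  have := ler_wpM2r bn0 bn; have := ler_wpM2r (ler0n R M) tb; lra.
move=> fin; apply: (infinite_setD inf (finite_II N)).
apply: sub_finite_set (finite_preimage (f := muln k) _ fin).
  by move=> n [/= /count cn /negP]; rewrite -leqNgt => /cn.
by move=> i j _ _ /eqP; rewrite eqn_pmul2l // => /eqP.
Qed.

End PushAll.

(** * Change of basepoint *)

(** Every vertex moves by at most [a := gdist x0 x0'], so distances change by at
    most [2 * a]; distinct vertices being at distance at least 1, the additive
    error is absorbed into a multiplicative one. *)
Lemma coarse_embedding_move (R : realType) (X : graph) (x0 x0' : X) :
  coarse_embedding R (fun x : X => if x == x0 then x0' else x).
Proof.
set f := fun x : X => _; set a := gdist x0 x0'.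
have fx x : (gdist x (f x) <= a)%N.
  by rewrite /f; case: eqVneq => [->|_]; rewrite ?gdistxx.
exists (2 * a + 1)%:R, (fun n => n - 2 * a)%N; split; first by rewrite ler1n addn1.
  by apply/cvgnyPge => m; exists (m + 2 * a)%N => // n /=; lia.
move=> x y; rewrite -natrM ler_nat.
have xfx := fx x; have yfy := fx y.
have := gdist_triangle x (f x) y; have := gdist_triangle (f x) (f y) y.
have := gdist_triangle (f x) x (f y); have := gdist_triangle x y (f y).
rewrite (gdist_sym (f x) x) (gdist_sym (f y) y) => h1 h2 h3 h4; split; first lia.
case: (eqVneq x y) => [->|/gdist_gt0]; first by rewrite !gdistxx.
nia.
Qed.

Theorem lemma2p5 (R : realType) :
  (forall (X Y : graph) (f : X -> Y) (x0 : X),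
      bounded_degree X -> bounded_degree Y ->
      coarse_embedding R f ->
      exponentially_many_fat_bigons R x0 ->
      exponentially_many_fat_bigons R (f x0)) /\
  (forall (X : graph) (x0 x0' : X),
      bounded_degree X ->
      (exponentially_many_fat_bigons R x0 <->
       exponentially_many_fat_bigons R x0')).
Proof.
split; first exact: exponentially_many_fat_bigons_push.
move=> X; suff H (x0 x0' : X) : bounded_degree X ->
    exponentially_many_fat_bigons R x0 -> exponentially_many_fat_bigons R x0'.
  by move=> x0 x0' degX; split; apply: H.
move=> degX; have := exponentially_many_fat_bigons_push (x0 := x0) degX degX
  (@coarse_embedding_move R X x0 x0').
by rewrite eqxx.
Qed.
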